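(* Let $X$ be a Hausdorff sequentially complete locally convex space over $\mathbb{C}$, let $\mathcal{A}$ be a multivalued linear operator in $X$, and let $C\in L(X)$ (not necessarily injective) satisfy $C\mathcal{A}\subseteq \mathcal{A}C$. Then the following holds. (i) For every $\lambda\in\rho_{C}(\mathcal{A})$, $$(\lambda-\mathcal{A})^{-1}C\mathcal{A}\subseteq \lambda(\lambda-\mathcal{A})^{-1}C-C\subseteq \mathcal{A}(\lambda-\mathcal{A})^{-1}C .$$ The operator $(\lambda-\mathcal{A})^{-1}C\mathcal{A}$ is single-valued on $D(\mathcal{A})$, and $(\lambda-\mathcal{A})^{-1}C\mathcal{A}x=(\lambda-\mathcal{A})^{-1}Cy$ whenever $y\in\mathcal{A}x$ and $\lambda\in\rho_{C}(\mathcal{A})$. (ii) For all $\lambda,\mu\in\rho_{C}(\mathcal{A})$ the resolvent equation $$(\lambda-\mathcal{A})^{-1}C^{2}x-(\mu-\mathcal{A})^{-1}C^{2}x=(\mu-\lambda)(\lambda-\mathcal{A})^{-1}C(\mu-\mathcal{A})^{-1}Cx,\quad x\in X,$$ holds. In particular, $(\lambda-\mathcal{A})^{-1}C(\mu-\mathcal{A})^{-1}C=(\mu-\mathcal{A})^{-1}C(\lambda-\mathcal{A})^{-1}C$.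
   Context: $L(X)$ is the space of continuous linear operators on $X$. A multivalued linear operator (MLO) in $X$ is a map $\mathcal{A}:X\to P(X)$ (power set) such that $D(\mathcal{A})=\{x:\mathcal{A}x\neq\emptyset\}$ is a linear subspace, $\mathcal{A}x+\mathcal{A}y\subseteq\mathcal{A}(x+y)$ for $x,y\in D(\mathcal{A})$, and $\lambda\mathcal{A}x\subseteq\mathcal{A}(\lambda x)$ for $\lambda\in\mathbb{C}$, $x\in D(\mathcal{A})$; equivalently, its graph $\{(x,y):y\in\mathcal{A}x\}$ is a linear subspace of $X\times X$, and $\mathcal{A}$ is identified with its graph. Inclusion $\mathcal{A}\subseteq\mathcal{B}$ means $D(\mathcal{A})\subseteq D(\mathcal{B})$ and $\mathcal{A}x\subseteq\mathcal{B}x$ for all $x\in D(\mathcal{A})$, i.e. inclusion of graphs. $R(\mathcal{A})=\bigcup_{x\in D(\mathcal{A})}\mathcal{A}x$. The inverse $\mathcal{A}^{-1}$ is the inverse relation. Sum: $D(\mathcal{A}+\mathcal{B})=D(\mathcal{A})\cap D(\mathcal{B})$, $(\mathcal{A}+\mathcal{B})x=\mathcal{A}x+\mathcal{B}x$. Product: $D(\mathcal{B}\mathcal{A})=\{x\in D(\mathcal{A}):D(\mathcal{B})\cap\mathcal{A}x\neq\emptyset\}$, $\mathcal{B}\mathcal{A}x=\mathcal{B}(D(\mathcal{B})\cap\mathcal{A}x)$ (composition of relations). $\lambda-\mathcal{A}$ means $\lambda I-\mathcal{A}$. The condition $C\mathcal{A}\subseteq\mathcal{A}C$ means: $(x,y)\in\mathcal{A}$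 implies $(Cx,Cy)\in\mathcal{A}$. The $C$-resolvent set $\rho_C(\mathcal{A})$ is the set of $\lambda\in\mathbb{C}$ such that $R(C)\subseteq R(\lambda-\mathcal{A})$ and $(\lambda-\mathcal{A})^{-1}C$ is a single-valued continuous linear operator on $X$. *)

(* Defs.v *)
From mathcomp Require Import all_boot all_order all_algebra.
From mathcomp Require Import all_classical all_reals topology normedtype.
From mathcomp Require Export complex.

Set Implicit Arguments.
Unset Strict Implicit.
Unset Printing Implicit Defensive.

Import GRing.Theory Num.Theory.
Import numFieldNormedType.Exports.

Local Open Scope classical_set_scope.
Local Open Scope ring_scope.

(* Cauchy sequences are taken with respect to the neighbourhoods of 0, and not
   with the library's [cauchy], because the entourages of a [tvsType] are only
   required to induce its topology: they need not be translation invariant. *)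
Definition cauchy_seq (K : numDomainType) (X : tvsType K) (u : nat -> X) :=
  forall U : set X, nbhs 0 U -> \forall m & n \near \oo, U (u m - u n).

Definition sequentially_complete (K : numDomainType) (X : tvsType K) :=
  forall u : nat -> X, cauchy_seq u -> exists l : X, u @ \oo --> l.

Section Relations.
Context (X : Type).
Implicit Types (A B : X -> set X) (x y : X).

Definition mdom A : set X := [set x | A x !=set0].

Definition mran A : set X := \bigcup_(x in mdom A) A x.

Definition mincl A B :=
  mdom A `<=` mdom B /\ forall x, mdom A x -> A x `<=` B x.

(* a single-valued operator, seen as a multivalued one *)
Definition mop (f : X -> X) : X -> set X := fun x => [set f x].

Definition minv A : X -> set X := fun y => [set x | A x y].

(* mdom (mcomp B A) is {x in mdom A | mdom B meets A x} *)
Definition mcomp B A : X -> set X :=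
  fun x => \bigcup_(y in mdom B `&` A x) B y.

End Relations.

Section MultivaluedOperators.
Context (K : numDomainType) (X : lmodType K).
Implicit Types (A B : X -> set X) (z : K) (x y : X).

Definition is_mlo A :=
  [/\ submod_closed [pred x | x \in mdom A],
      forall x y, mdom A x -> mdom A y ->
        [set a + b | a in A x & b in A y] `<=` A (x + y) &
      forall z x, mdom A x -> [set z *: a | a in A x] `<=` A (z *: x)].

Definition mscale z A : X -> set X := fun x => [set z *: a | a in A x].

(* mdom (madd A B) is mdom A `&` mdom B *)
Definition madd A B : X -> set X :=
  fun x => [set a + b | a in A x & b in B x].

Definition msub A B : X -> set X := madd A (mscale (-1) B).

(* z - A, that is z I - A *)
Definition mshift z A : X -> set X := msub (mscale z (mop id)) A.

(* (z - A)^-1 C *)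
Definition mresolvent (C : X -> X) A z : X -> set X :=
  mcomp (minv (mshift z A)) (mop C).

End MultivaluedOperators.

(* B is (the graph of) an everywhere defined continuous linear operator *)
Definition is_continuous_operator (K : numDomainType) (X : tvsType K)
    (B : X -> set X) :=
  exists2 T : {linear X -> X}, continuous T & B = mop T.

Definition resolvent_set (K : numDomainType) (X : tvsType K)
    (C : X -> X) (A : X -> set X) : set K :=
  [set z | range C `<=` mran (mshift z A) /\
           is_continuous_operator (mresolvent C A z)].

(* Main.v *)
Require Import Defs.
From mathcomp Require Import all_boot all_order all_algebra.
From mathcomp Require Import all_classical all_reals topology normedtype.

Set Implicit Arguments.
Unset Strict Implicit.
Unset Printing Implicit Defensive.

(** Everything follows from reading the C-resolvent off the graph of the
    operator: z belongs to (l - A)^-1 C x exactly when (z, l z - C x) lies in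
    A ([mresolventE]).  So when l is in the C-resolvent set, with
    T_l = (l - A)^-1 C, membership of (z, l z - C x) in A is a test for the
    equality z = T_l x, and each identity is proved by producing the right
    element of A.

    Let (x, y) be in A.  Then (C x, C y) is in A too, since C A is included in
    A C, and subtracting this pair from l times (T_l x, l T_l x - C x) gives
    an element of A which says that T_l y = l T_l x - C x ([resolvent_image]).
    This is the first inclusion of (i), and it shows that T_l y depends on x
    only; the second inclusion is the membership of (T_l x, l T_l x - C x)
    itself.

    Applying C to both entries of that same element shows that C commutes with
    T_l ([resolvent_commutes]).  Instantiating the identity of (i) at
    (T_m x, m T_m x - C x) then gives the resolvent equation, and exchanging
    the two parameters in the equation makes T_l and T_m commute. *)

Import GRing.Theory Num.Theory.

Local Open Scope classical_set_scope.
Local Open Scope ring_scope.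

Lemma mcompE (X : Type) (A B : X -> set X) (x z : X) :
  mcomp B A x z <-> exists2 y, A x y & B y z.
Proof.
split=> [[y [_ Axy] Byz]|[y Axy Byz]]; first by exists y.
by exists y => //; split=> //; exists z.
Qed.

Lemma mcomp_mopr (X : Type) (B : X -> set X) (f : X -> X) (x : X) :
  mcomp B (mop f) x = B (f x).
Proof.
apply/seteqP; split=> z; first by move=> /mcompE[y -> Bz].
by move=> Bz; apply/mcompE; exists (f x).
Qed.

Lemma mcomp_mop (X : Type) (f g : X -> X) :
  mcomp (mop f) (mop g) = mop (f \o g).
Proof. by apply/funext => x; rewrite mcomp_mopr. Qed.

Lemma mincl_graph (X : Type) (A B : X -> set X) :
  mincl A B <-> forall x y, A x y -> B x y.
Proof.
split=> [[_ AB] x y Axy|AB]; first by apply: AB => //; exists y.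
by split=> [x [y /AB Bxy]|x _ y]; [exists y|exact: AB].
Qed.

Lemma mscale_mop (K : numDomainType) (X : lmodType K) (c : K) (f : X -> X) :
  mscale c (mop f) = mop (fun x => c *: f x).
Proof. by apply/funext => x; exact: image_set1. Qed.

Lemma msub_mop (K : numDomainType) (X : lmodType K) (f g : X -> X) :
  msub (mop f) (mop g) = mop (fun x => f x - g x).
Proof.
apply/funext => x; rewrite /msub mscale_mop /madd /mop.
apply/seteqP; split=> [_ [_ -> [_ -> <-]]|_ ->]; first by rewrite scaleN1r.
by exists (f x) => //; exists (-1 *: g x) => //; rewrite scaleN1r.
Qed.

Section MloGraph.
Context (K : numDomainType) (X : lmodType K) (A : X -> set X).
Hypothesis A_mlo : is_mlo A.

Lemma mloZ (c : K) (x y : X) : A x y -> A (c *: x) (c *: y).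
Proof.
by case: A_mlo => _ _ AZ Axy; apply: AZ; [exists y|exists y].
Qed.

Lemma mloB (x y x' y' : X) : A x y -> A x' y' -> A (x - x') (y - y').
Proof.
case: (A_mlo) => _ AD _ Axy /(mloZ (-1)); rewrite !scaleN1r => Axy'.
by apply: AD; [exists y|exists (- y')|exists y => //; exists (- y')].
Qed.

End MloGraph.

Section Resolvent.
Context (K : numDomainType) (X : lmodType K) (A : X -> set X).
Implicit Types (l : K) (x y z : X).

Lemma mshiftE l z y : mshift l A z y <-> A z (l *: z - y).
Proof.
split=> [[_ [_ -> <-] [_ [a Aza <-] <-]]|Azy].
  by rewrite scaleN1r opprB addrC subrK.
exists (l *: z); first by exists z.
exists (-1 *: (l *: z - y)); first by exists (l *: z - y).
by rewrite scaleN1r opprB addrC subrK.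
Qed.

(** Inverse, shift and composition disappear: questions about the resolvent
    become questions about which pairs belong to the graph of A, and these
    are settled by linearity. *)
Lemma mresolventE (C : X -> X) l x z :
  mresolvent C A l x z <-> A z (l *: z - C x).
Proof. by rewrite /mresolvent mcomp_mopr; exact: mshiftE. Qed.

(** Turns the operators (l - A)^-1 C^2 of the resolvent equation into
    T_l C, so that the equation involves single-valued maps only. *)
Lemma mresolvent_sqr (C : X -> X) l :
  mcomp (minv (mshift l A)) (mcomp (mop C) (mop C)) =
  mcomp (mresolvent C A l) (mop C).
Proof.
by apply/funext => x; rewrite mcomp_mop /mresolvent !mcomp_mopr.
Qed.

Section SingleValued.
Context (C : X -> X) (l : K) (T : X -> X).
Hypothesis TE : mresolvent C A l = mop T.

Lemma resolvent_graph x : A (T x) (l *: T x - C x).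
Proof. by apply/mresolventE; rewrite TE. Qed.

Lemma resolvent_eq x z : A z (l *: z - C x) -> z = T x.
Proof. by move=> /mresolventE; rewrite TE. Qed.

Hypothesis A_mlo : is_mlo A.
Hypothesis CA : forall x y, A x y -> A (C x) (C y).

(** The pair l (T x, l T x - C x) - (C x, C y) of A has the form
    (z, l z - C y) with z = l T x - C x. *)
Lemma resolvent_image x y : A x y -> T y = l *: T x - C x.
Proof.
move=> /CA ACxy; apply/esym/resolvent_eq.
have lTx := mloZ A_mlo l (resolvent_graph x).
by have := mloB A_mlo lTx ACxy.
Qed.

End SingleValued.

(** C maps the pair (T x, l T x - C x) of A to (C T x, l C T x - C C x), which
    is the pair that characterizes T (C x). *)
Lemma resolvent_commutes (C : {linear X -> X}) l (T : X -> X) :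
    mresolvent C A l = mop T -> (forall x y, A x y -> A (C x) (C y)) ->
  forall x, C (T x) = T (C x).
Proof.
move=> TE CA x; apply: (resolvent_eq TE).
by have := CA _ _ (resolvent_graph TE x); rewrite linearB linearZ.
Qed.

(** The identity T y = l T x' - C x' is used at the pair
    (x', y) = (S x, m S x - C x) of A; as C S = S C, it reads
    m T S x - T C x = l T S x - S C x. *)
Lemma resolvent_equation (C : {linear X -> X}) l m (T S : {linear X -> X}) :
    is_mlo A -> (forall x y, A x y -> A (C x) (C y)) ->
    mresolvent C A l = mop T -> mresolvent C A m = mop S ->
  forall x, T (C x) - S (C x) = (m - l) *: T (S x).
Proof.
move=> A_mlo CA TE SE x.
have := resolvent_image TE A_mlo CA (resolvent_graph SE x).
rewrite linearB linearZ /= (resolvent_commutes SE CA) => TSx.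
rewrite -[T (C x)](subKr (m *: T (S x))) TSx opprD opprK addrA addrK.
by rewrite scalerBl.
Qed.

End Resolvent.

(** The left-hand side of the resolvent equation changes sign when the two
    parameters are exchanged, so the equation settles the case l != m. *)
Lemma resolvents_commute (K : numFieldType) (X : lmodType K) (A : X -> set X)
    (C : {linear X -> X}) (l m : K) (T S : {linear X -> X}) :
    is_mlo A -> (forall x y, A x y -> A (C x) (C y)) ->
    mresolvent C A l = mop T -> mresolvent C A m = mop S ->
  forall x, T (S x) = S (T x).
Proof.
move=> A_mlo CA TE SE x; have [lm|lm] := eqVneq l m.
  (* both T and S are then the same single-valued resolvent *)
  have TS y : T y = S y.
    by apply: (resolvent_eq SE); rewrite -lm; exact: resolvent_graph TE y.
  by rewrite !TS.
have ml0 : m - l != 0 by rewrite subr_eq0 eq_sym.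
apply: (scalerI ml0); rewrite -(resolvent_equation A_mlo CA TE SE).
by rewrite -opprB (resolvent_equation A_mlo CA SE TE) -scaleNr opprB.
Qed.

Theorem theorem2p2 (R : realType) (X : tvsType R[i])
    (X_hausdorff : hausdorff_space X)
    (X_complete : sequentially_complete X)
    (A : X -> set X) (A_mlo : is_mlo A)
    (C : {linear X -> X}) (C_continuous : continuous C)
    (CA_AC : mincl (mcomp (mop C) A) (mcomp A (mop C))) :
  (* (i) *)
  (forall l : R[i], resolvent_set C A l ->
    [/\ mincl (mcomp (mresolvent C A l) A)
              (msub (mscale l (mresolvent C A l)) (mop C)),
        mincl (msub (mscale l (mresolvent C A l)) (mop C))
              (mcomp A (mresolvent C A l)),
        forall x : X, mdom A x ->
          exists z : X, mcomp (mresolvent C A l) A x = [set z] &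
        forall x y : X, A x y ->
          mcomp (mresolvent C A l) A x = mresolvent C A l y]) /\
  (* (ii) *)
  (forall l m : R[i], resolvent_set C A l -> resolvent_set C A m ->
    (forall x : X,
      msub (mcomp (minv (mshift l A)) (mcomp (mop C) (mop C)))
           (mcomp (minv (mshift m A)) (mcomp (mop C) (mop C))) x =
      mscale (m - l) (mcomp (mresolvent C A l) (mresolvent C A m)) x) /\
    mcomp (mresolvent C A l) (mresolvent C A m) =
    mcomp (mresolvent C A m) (mresolvent C A l)).
Proof.
have CA x y : A x y -> A (C x) (C y).
  move=> Axy; move/mincl_graph: CA_AC => /(_ x (C y)); rewrite mcomp_mopr.
  by apply; apply/mcompE; exists y.
split=> [l [_ [T _ TE]]|l m [_ [T _ TE]] [_ [S _ SE]]].
  have imT x y (Axy : A x y) : mcomp (mresolvent C A l) A x = [set T y].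
    rewrite TE; apply/seteqP; split=> z; last first.
      by move=> ->; apply/mcompE; exists y.
    move=> /mcompE[y' Axy' ->] /=.
    have Tx := resolvent_image TE A_mlo CA.
    by rewrite (Tx _ _ Axy) (Tx _ _ Axy').
  split.
  - apply/mincl_graph => x z; rewrite TE mscale_mop msub_mop => /mcompE[y Axy ->].
    exact: (resolvent_image TE A_mlo CA).
  - rewrite TE mscale_mop msub_mop; apply/mincl_graph => x z ->.
    by rewrite mcomp_mopr; exact: resolvent_graph TE x.
  - by move=> x [y Axy]; exists (T y); exact: imT.
  - by move=> x y Axy; rewrite (imT x y Axy) TE.
split=> [x|].
  rewrite !mresolvent_sqr TE SE !mcomp_mop msub_mop mscale_mop /mop /=.
  by rewrite (resolvent_equation A_mlo CA TE SE).
rewrite TE SE !mcomp_mop; congr mop; apply/funext => x.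
exact: (resolvents_commute A_mlo CA TE SE).
Qed.
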